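(* Let $k,k_u\in\mathbb{N}=\{1,2,\dots\}$ with $k\le k_u$, and consider the games of cardinality $k$. (i) The distribution rule $f^\star_{k_u}$ has performance $$\mathrm{PoA}(f^\star_{k_u},k)=\mathrm{PoA}(f^\star_{k_u},k_u).$$ This performance is strictly worse than the one achieved by $f^\star_k$ if $k<k_u$, i.e. $\mathrm{PoA}(f^\star_{k_u},k)<\mathrm{PoA}(f^\star_k,k)$, and equal to it if $k=k_u$. (ii) For $1<k_d<k$ the distribution rule $f'_{k_d}:[k_u]\to\mathbb{R}_{\ge0}$ has performance $$\mathrm{PoA}(f'_{k_d},k)=\mathrm{PoA}(f'_{k_d},k_u),$$ which is strictly worse than the one achieved by $f^\star_{k_u}$, i.e. $\mathrm{PoA}(f'_{k_d},k)<\mathrm{PoA}(f^\star_{k_u},k)$. For $k\le k_d<k_u$ the distribution rule $f'_{k_d}:[k_u]\to\mathbb{R}_{\ge0}$ has performance $$\mathrm{PoA}(f'_{k_d},k)=\mathrm{PoA}(f^\star_{k_d},k_d),$$ which is strictly better than the one achieved by $f^\star_{k_u}$, i.e. $\mathrm{PoA}(f'_{k_d},k)>\mathrm{PoA}(f^\star_{k_u},k)$.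
   Context: Notation: $[p]=\{1,\dots,p\}$; $k,k_u,k_d$ are integers. Covering problem: $C=\{N,\mathcal{R},\{\mathcal{A}^i\}_{i\in N},\{v_r\}_{r\in\mathcal{R}}\}$ consists of a finite set of agents $N=\{1,\dots,n\}$, a finite set of resources $\mathcal{R}$, non-empty action sets $\mathcal{A}^i\subseteq 2^{\mathcal{R}}$, and values $v_r\ge 0$. An allocation is $a=(a^1,\dots,a^n)\in\mathcal{A}=\mathcal{A}^1\times\dots\times\mathcal{A}^n$; $|a|_r$ is the number of agents $i$ with $r\in a^i$. The welfare is $W(a)=\sum_{r:\,|a|_r\ge1}v_r$. The cardinality of $C$ is $\max_{r\in\mathcal{R},\,a\in\mathcal{A}}|a|_r$. Covering game: given $C$ of cardinality $k$ and a distribution rule $f$ (a function to $\mathbb{R}_{\ge0}$ whose domain contains $[k]$), the game $G=\{C,f\}$ has utilities $u^i(a^i,a^{-i})=\sum_{r\in a^i}v_r f(|a|_r)$. $\mathrm{NE}(G)$ is the set of pure Nash equilibria, i.e. allocations $a_e$ with $u^i(a_e^i,a_e^{-i})\ge u^i(a^i,a_e^{-i})$ for all $i\in N$ and all $a^i\in\mathcal{A}^i$. $\mathcal{G}_f^k$ is the set of all games $G=\{C,f\}$ with $C$ of cardinality exactly $k$ (with any number of agents, resources, action sets and values), and $$\mathrm{PoA}(f,k)=\inf_{G\in\mathcal{G}_f^k}\frac{\min_{a\in\mathrm{NE}(G)}W(a)}{\max_{a\in\mathcal{A}}W(a)},$$ where games with $\max_a W(a)=0$ are disregarded. If $f$ is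 defined on a larger set than $[k]$, only its values on $[k]$ matter. For an integer $k\ge2$, $f^\star_k:[k]\to\mathbb{R}_{\ge0}$ is $$f^\star_k(j)=(j-1)!\,\frac{\frac{1}{(k-1)(k-1)!}+\sum_{i=j}^{k-1}\frac{1}{i!}}{\frac{1}{(k-1)(k-1)!}+\sum_{i=1}^{k-1}\frac{1}{i!}},\quad j\in[k],$$ and $f^\star_1(1)=1$. Given $k_u$, let $\mathcal{F}=\{f:[k_u]\to\mathbb{R}_{\ge0}:\ f(1)=1,\ f(j+1)\le f(j)\ \forall j\in[k_u-1]\}$. For $1<k_d<k_u$ (and only for such $k_d$), the rule $f'_{k_d}:[k_u]\to\mathbb{R}_{\ge0}$ is defined as a maximiser of $\mathrm{PoA}(f,k_u)$ over all $f\in\mathcal{F}$ satisfying $f(j)=f^\star_{k_d}(j)$ for all $j\in[k_d]$.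
   Formalization: The case k = 1 < k_u is excluded, because the claims fail there: games of cardinality 1 have price of anarchy 1 under every rule with f(1) = 1, so the stated equalities and strict inequalities are false. *)

(* Defs.v *)
From HB Require Import structures.
From mathcomp Require Import all_boot all_order all_algebra.
From mathcomp Require Import classical_sets reals.
Set Implicit Arguments.
Unset Strict Implicit.
Unset Printing Implicit Defensive.
Import Order.TTheory GRing.Theory Num.Theory.
Local Open Scope ring_scope.
Local Open Scope classical_set_scope.

Record covering (R : realType) := Covering {
  agents : nat;
  resource : finType;
  action : 'I_agents -> {set {set resource}};
  action_neq0 : forall i, action i != finset.set0;
  value : resource -> R;
  value_ge0 : forall r, 0 <= value r }.

Section Covering.
Variables (R : realType) (C : covering R).

Definition profile := {ffun 'I_(agents C) -> {set resource C}}.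

Definition allocations : {set profile} :=
  [set a : profile | [forall i, a i \in action i]]%SET.

Definition load (a : profile) (r : resource C) : nat :=
  #|[set i | r \in a i]%SET|.

Definition welfare (a : profile) : R :=
  \sum_(r | (1 <= load a r)%N) value r.

Definition cardinality : nat :=
  (\max_(r : resource C) \max_(a in allocations) load a r)%N.

(* A distribution rule is a function on nat; every statement about it only
   involves its values at the positive integers up to the relevant bound. *)
Definition utility (f : nat -> R) (i : 'I_(agents C)) (a : profile) : R :=
  \sum_(r in a i) value r * f (load a r).

Definition deviate (a : profile) (i : 'I_(agents C)) (b : {set resource C}) :
  profile := [ffun j => if j == i then b else a j].

Definition nash (f : nat -> R) : {set profile} :=
  [set a in allocations | [forall i, forall b in action i,
     utility f i (deviate a i b) <= utility f i a]]%SET.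

Definition worst_nash (f : nat -> R) (a : profile) : Prop :=
  a \in nash f /\ (forall b, b \in nash f -> welfare a <= welfare b).

Definition optimal (a : profile) : Prop :=
  a \in allocations /\ (forall b, b \in allocations -> welfare b <= welfare a).

End Covering.

(* Pure Nash equilibria always exist (these are congestion games), so no
   covering problem of cardinality k with positive optimal welfare is lost by
   asking for an allocation that attains the minimum over the equilibria. *)
Definition efficiency_ratios (R : realType) (f : nat -> R) (k : nat) : set R :=
  [set x | exists (C : covering R) (ae ao : profile C),
     [/\ cardinality C = k, worst_nash f ae, optimal ao, 0 < welfare ao
       & x = welfare ae / welfare ao]].

Definition PoA (R : realType) (f : nat -> R) (k : nat) : R :=
  inf (efficiency_ratios f k).

Definition fstar_num (R : realType) (k j : nat) : R :=
  ((k.-1)%:R * (k.-1)`!%:R)^-1 + \sum_(j <= i < k) (i`!%:R)^-1.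

(* Meaningful for 1 <= j <= k only. *)
Definition fstar (R : realType) (k j : nat) : R :=
  if (k <= 1)%N then 1
  else (j.-1)`!%:R * (fstar_num R k j / fstar_num R k 1).

Definition admissible (R : realType) (ku : nat) (f : nat -> R) : Prop :=
  [/\ forall j, (1 <= j <= ku)%N -> 0 <= f j,
      f 1%N = 1
    & forall j, (1 <= j < ku)%N -> f j.+1 <= f j].

Definition extends_fstar (R : realType) (kd : nat) (f : nat -> R) : Prop :=
  forall j, (1 <= j <= kd)%N -> f j = fstar R kd j.

(* The rules f'_kd: the maximisers of PoA(., ku) among the admissible rules on
   [ku] that agree with fstar kd on [kd]. *)
Definition optimal_extension (R : realType) (kd ku : nat) (f' : nat -> R) :
    Prop :=
  [/\ admissible ku f', extends_fstar kd f'
    & forall f, admissible ku f -> extends_fstar kd f -> PoA f ku <= PoA f' ku].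

(* Main.v *)
(* For an admissible rule f, PoA(f, k) = 1 / (1 + x), where x is the largest of
   the costs j f(j) - f(j+1), 1 <= j < k, and (k-1) f(k). The lower bound is a
   smoothness argument carried out resource by resource; each cost is attained
   in a game whose agents are indifferent between overcrowding the same
   resources and spreading over private ones. The rule fstar_m makes all its costs equal to
   1 / N_m(1), where N_m = fstar_num m is strictly decreasing in m. An optimal
   extension of fstar_kd to [ku] is forced to have equal costs beyond kd, which
   determines it there as a multiple of (j-1)! N_ku(j), so that its cost at
   j = kd already attains the maximum. *)
Require Import Defs.
From mathcomp Require Import all_boot all_order all_algebra.
From mathcomp Require Import classical_sets reals.
From mathcomp Require Import lra ring zify.
Set Implicit Arguments.
Unset Strict Implicit.
Unset Printing Implicit Defensive.
Import Order.TTheory GRing.Theory Num.Theory.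
Local Open Scope ring_scope.

(** * Smoothness: a lower bound on equilibrium welfare *)

Section Smoothness.
Variables (R : realType) (C : covering R).
Implicit Types (a : profile C) (r : resource C) (f : nat -> R) (x : R).

Lemma allocationP a : reflect (forall i, a i \in action i) (a \in allocations C).
Proof. by rewrite inE; exact: forallP. Qed.

Lemma load_le_cardinality a r :
  a \in allocations C -> (load a r <= cardinality C)%N.
Proof.
move=> Ha; apply: leq_trans (leq_bigmax r).
exact: (@leq_bigmax_cond _ (mem (allocations C)) (fun b => load b r)).
Qed.

Lemma deviate_allocation a i b :
  a \in allocations C -> b \in action i -> deviate a i b \in allocations C.
Proof.
move=> /allocationP Ha Hb; apply/allocationP => j.
by rewrite ffunE; case: eqP => [->|_].
Qed.

Lemma load_gt0 a i r : r \in a i -> (0 < load a r)%N.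
Proof. by move=> Hr; apply/card_gt0P; exists i; rewrite inE. Qed.

Lemma load_deviate a i (b : {set resource C}) r :
  r \in b -> load (deviate a i b) r = ((r \notin a i) + load a r)%N.
Proof.
move=> Hr; rewrite /load.
have -> : [set j | r \in deviate a i b j]%SET = (i |: [set j | r \in a j])%SET.
  by apply/setP => j; rewrite !inE ffunE; case: eqP => [->|].
by rewrite cardsU1 inE.
Qed.

Lemma sum_utility f a :
  \sum_i utility f i a = \sum_r value r * ((load a r)%:R * f (load a r)).
Proof.
rewrite /utility (exchange_big_dep predT) //=; apply: eq_bigr => r _.
by rewrite sumr_const mulrCA mulr_natl /load cardsE.
Qed.

Lemma sum_utility_deviate f a b :
  \sum_i utility f i (deviate a i (b i)) =
  \sum_r value r * \sum_(i | r \in b i) f ((r \notin a i) + load a r)%N.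
Proof.
have -> : \sum_i utility f i (deviate a i (b i)) =
    \sum_i \sum_(r in b i) value r * f ((r \notin a i) + load a r)%N.
  apply: eq_bigr => i _; rewrite /utility ffunE eqxx.
  by apply: eq_bigr => r Hr; rewrite load_deviate.
rewrite (exchange_big_dep predT) //=; apply: eq_bigr => r _.
by rewrite mulr_sumr.
Qed.

Lemma admissible_le1 k f j :
  admissible k f -> (1 <= j <= k)%N -> f j <= 1.
Proof.
case=> _ f1 fle; elim: j => // -[|j] IH Hj; first by rewrite f1.
by apply: le_trans (IH _); [apply: fle|]; lia.
Qed.

Lemma admissible_pred_mul k f x j :
    admissible k f ->
    (forall j, (1 <= j < k)%N -> j%:R * f j - f j.+1 <= x) ->
    (k.-1)%:R * f k <= x ->
  (1 <= j <= k)%N -> j%:R * f j - f j <= x.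
Proof.
case=> _ _ fle Hx Hk Hj; have [jk|jk] := ltnP j k.
  by apply: le_trans (Hx j _); [rewrite lerD2l lerN2 fle|]; lia.
have <- : k = j by lia.
have k0 : (0 < k)%N by lia.
by rewrite -(prednK k0) -natr1 mulrDl mul1r addrK prednK.
Qed.

Lemma welfareE a : welfare a = \sum_r value r * (1 <= load a r)%N%:R.
Proof.
rewrite /welfare big_mkcond /=; apply: eq_bigr => r _.
by case: ifP; rewrite ?mulr1 ?mulr0.
Qed.

(** Adding up the equilibrium inequalities for the deviations to [ao i] and regrouping by resource
    leaves one inequality per resource, in its loads under [ae] and [ao]. *)
Lemma nash_welfare k f x ae ao :
    admissible k f -> cardinality C = k ->
    (forall j, (1 <= j < k)%N -> j%:R * f j - f j.+1 <= x) ->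
    (k.-1)%:R * f k <= x ->
    ae \in nash C f -> ao \in allocations C ->
  welfare ao <= (1 + x) * welfare ae.
Proof.
move=> fadm Ck Hx Hk; rewrite inE => /andP[He /forallP Hne] Ho.
have [f0 f1 fle] := fadm.
have load_le a r : a \in allocations C -> (load a r <= k)%N.
  by rewrite -Ck; exact: load_le_cardinality.
have dev_le i : utility f i (deviate ae i (ao i)) <= utility f i ae.
  by have /forallP/(_ (ao i))/implyP := Hne i; apply; apply/allocationP.
have : \sum_i utility f i (deviate ae i (ao i)) <= \sum_i utility f i ae.
  by apply: ler_sum => i _; exact: dev_le.
rewrite sum_utility sum_utility_deviate -subr_ge0 -sumrB => Hsum.
rewrite -subr_ge0 !welfareE mulr_sumr -sumrB; apply: le_trans Hsum _.
apply: ler_sum => r _.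
rewrite [(1 + x) * _]mulrCA -!mulrBr; apply: ler_wpM2l; first exact: value_ge0.
set l := load ae r.
have l_le : (l <= k)%N by exact: load_le.
have dev_in i : r \in ao i -> (1 <= (r \notin ae i) + l <= k)%N.
  move=> ri; rewrite -(load_deviate _ _ ri) load_le ?andbT.
    by apply: (@load_gt0 _ i); rewrite ffunE eqxx.
  by apply: deviate_allocation => //; exact/allocationP.
have lfl : (1 <= l)%N -> l%:R * f l - f l <= x.
  by move=> l1; apply: (admissible_pred_mul fadm Hx Hk); rewrite l1.
have [b0|bpos] := posnP (load ao r); last first.
  (* One user [i] of [r] in [ao] suffices, the other terms being nonnegative. If [i] is new to [r],
     [dev_in] gives [l < k], so the cost at [l] is available when [l > 0]. *)
  have /card_gt0P[i] := bpos; rewrite inE => ri.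
  rewrite (bigD1 i) //=.
  have : 0 <= \sum_(j | (r \in ao j) && (j != i)) f ((r \notin ae j) + l)%N.
    by apply: sumr_ge0 => j /andP[rj _]; apply/f0/dev_in.
  have := dev_in i ri.
  case: (boolP (r \in ae i)) => rin /=.
    rewrite add0n => /andP[l1 _]; rewrite l1 mulr1.
    by have := lfl l1; lra.
  rewrite add1n; case: (posnP l) => [->|l1] lk.
    by rewrite f1 /=; lra.
  by have := Hx l; rewrite l1 mulr1 lk => /(_ isT); lra.
rewrite big_pred0 => [|i]; last first.
  by apply/negP => /load_gt0; rewrite b0.
case: (posnP l) => [->|l1]; first by (rewrite mul0r /= mulr0; lra).
have lk : (1 <= l <= k)%N by apply/andP.
by have := lfl l1; have := admissible_le1 fadm lk; rewrite mulr1 /=; lra.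
Qed.

End Smoothness.

(** * From single games to the price of anarchy *)

Lemma welfare_ge0 (R : realType) (C : covering R) (a : profile C) :
  0 <= welfare a.
Proof. by apply: sumr_ge0 => r _; exact: value_ge0. Qed.

Lemma efficiency_ratios_ge0 (R : realType) (f : nat -> R) k x :
  efficiency_ratios f k x -> 0 <= x.
Proof.
by case=> C [ae [ao [_ _ _ _ ->]]]; rewrite divr_ge0 // welfare_ge0.
Qed.

(** Passing to a worst equilibrium and an optimum only lowers the ratio. Nonemptiness is recorded
    for [PoA_ge], since the infimum of an empty set is a default value. *)
Lemma PoA_le_nash (R : realType) (C : covering R) (f : nat -> R) (c : R)
    (ae ao : profile C) :
    ae \in nash C f -> ao \in allocations C -> 0 < welfare ao ->
    welfare ae <= c * welfare ao ->
  (efficiency_ratios f (cardinality C) !=set0)%classic /\ PoA f (cardinality C) <= c.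
Proof.
move=> He Ho Wo Wc.
case: (arg_minP (fun b : profile C => welfare b) He) => aw Hw wmin.
case: (arg_maxP (fun b : profile C => welfare b) Ho) => am Hm mmax.
have Wm : welfare ao <= welfare am by exact: mmax.
have Wm0 : 0 < welfare am by exact: lt_le_trans Wm.
have Hratio : efficiency_ratios f (cardinality C) (welfare aw / welfare am).
  by exists C, aw, am; split=> //; split.
split; first by exists (welfare aw / welfare am).
apply: (@le_trans _ _ (welfare aw / welfare am)).
  by apply: ge_inf => //; exists 0 => x /efficiency_ratios_ge0.
have c0 : 0 <= c.
  by rewrite -(pmulr_lge0 _ Wo); apply: le_trans Wc; exact: welfare_ge0.
rewrite ler_pdivrMr //; apply: le_trans (wmin _ He) _; apply: le_trans Wc _.
exact: ler_wpM2l.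
Qed.

Lemma PoA_ge (R : realType) (f : nat -> R) (k : nat) (x : R) :
    admissible k f -> 0 <= x ->
    (forall j, (1 <= j < k)%N -> j%:R * f j - f j.+1 <= x) ->
    (k.-1)%:R * f k <= x ->
    (efficiency_ratios f k !=set0)%classic ->
  (1 + x)^-1 <= PoA f k.
Proof.
move=> fadm x0 Hx Hk Hne; apply: lb_le_inf => // y.
case=> C [ae [ao [Ck [He _] [Ho _] Wo ->]]].
have x1 : 0 < 1 + x by lra.
rewrite ler_pdivlMr // ler_pdivrMl //.
exact: (nash_welfare fadm Ck Hx Hk).
Qed.

(** * Games attaining each cost *)

(* Each agent i < n chooses between tight_ne i, all the resources
   A_r = inr (inl r) of value 1 (except A_i if b is false), and tight_opt i, namely A_i
   together with a private resource B_i = inr (inr i) of value w. The worthless resource inl tt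
   is always chosen, by all k agents: it raises the cardinality to exactly k. *)
Section TightGame.
Variables (R : realType) (k n : nat) (b : bool) (w : R).
Hypotheses (n_le_k : (n <= k)%N) (w_ge0 : 0 <= w) (load_pos : (~~ b < n)%N).

Let T : finType := (unit + ('I_n + 'I_n))%type.

Definition tight_ne (i : 'I_k) : {set T} :=
  [set x : T | match x with
               | inl _ => true
               | inr (inl r) => (i < n)%N && (b || (r != i :> nat))
               | inr (inr _) => false
               end].

Definition tight_opt (i : 'I_k) : {set T} :=
  [set x : T | match x with
               | inl _ => true
               | inr (inl r) | inr (inr r) => r == i :> nat
               end].

Definition tight_value (x : T) : R :=
  match x with inl _ => 0 | inr (inl _) => 1 | inr (inr _) => w end.

Lemma tight_action_neq0 (i : 'I_k) :
  [set tight_ne i; tight_opt i]%SET != finset.set0.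
Proof. by apply/set0Pn; exists (tight_ne i); rewrite !inE eqxx. Qed.

Lemma tight_value_ge0 x : 0 <= tight_value x.
Proof. by case: x => [|[]]. Qed.

Definition tight_game : covering R :=
  Covering tight_action_neq0 tight_value_ge0.

Definition tight_ae : profile tight_game := [ffun i => tight_ne i].
Definition tight_ao : profile tight_game := [ffun i => tight_opt i].

Lemma tight_ae_allocation : tight_ae \in allocations tight_game.
Proof. by apply/allocationP => i; rewrite ffunE !inE eqxx. Qed.

Lemma tight_ao_allocation : tight_ao \in allocations tight_game.
Proof. by apply/allocationP => i; rewrite ffunE !inE eqxx orbT. Qed.

Lemma tight_load_A (r : 'I_n) : load tight_ae (inr (inl r)) = (n - ~~ b)%N.
Proof.
rewrite /load.
have card_lt : #|[set i : 'I_k | (i < n)%N]%SET| = n.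
  have -> : [set i : 'I_k | (i < n)%N]%SET = (widen_ord n_le_k @: finset.setT)%SET.
    apply/setP => i; rewrite inE; apply/idP/imsetP => [ilt|[j _ ->]] //=.
    by exists (Ordinal ilt) => //; apply: val_inj.
  rewrite card_imset ?cardsT ?card_ord // => i j /(congr1 val) /= ij.
  exact: val_inj.
have -> : [set i | inr (inl r) \in tight_ae i]%SET =
    (if b then [set i : 'I_k | (i < n)%N]
     else [set i : 'I_k | (i < n)%N] :\ widen_ord n_le_k r)%SET.
  apply/setP => i; rewrite !inE ffunE inE; case: (b) => /=.
    by rewrite andbT inE.
  by rewrite !inE andbC -val_eqE /= eq_sym.
case: (b) => /=; rewrite ?subn0 //.
rewrite -[in RHS]card_lt (cardsD1 (widen_ord n_le_k r) [set i : 'I_k | _]).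
by rewrite inE /= ltn_ord addnC addnK.
Qed.

Lemma tight_load_B (r : 'I_n) : load tight_ae (inr (inr r)) = 0%N.
Proof.
by apply/eqP; rewrite cards_eq0; apply/eqP/setP => i; rewrite !inE ffunE inE.
Qed.

Lemma tight_cardinality : cardinality tight_game = k.
Proof.
apply/anti_leq/andP; split.
  apply/bigmax_leqP => x _; apply/bigmax_leqP => a _.
  by apply: leq_trans (max_card _) _; rewrite card_ord.
have <- : load tight_ae (inl tt) = k.
  rewrite /load -[RHS]card_ord -cardsT; congr #|pred_of_set _|.
  by apply/setP => i; rewrite !inE ffunE inE.
exact: load_le_cardinality tight_ae_allocation.
Qed.

Lemma tight_sum (P : pred T) (F : T -> R) :
  F (inl tt) = 0 ->
  \sum_(x : T | P x) F x =
    \sum_(r | P (inr (inl r))) F (inr (inl r)) +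
    \sum_(r | P (inr (inr r))) F (inr (inr r)).
Proof.
by move=> F0; rewrite !big_sumType /= big1 ?add0r // => -[] _.
Qed.

Lemma tight_welfare_ae : welfare tight_ae = n%:R.
Proof.
rewrite /welfare tight_sum //= [X in _ + X]big_pred0 => [|r]; last first.
  by rewrite tight_load_B.
rewrite addr0 (eq_bigl xpredT) => [|r]; last by rewrite tight_load_A subn_gt0.
by rewrite sumr_const card_ord.
Qed.

Lemma tight_welfare_ao : welfare tight_ao = n%:R * (1 + w).
Proof.
have covered x : (1 <= load tight_ao (inr x))%N.
  by case: x => r; apply: (@load_gt0 _ tight_game _ (widen_ord n_le_k r));
     rewrite ffunE inE /=.
rewrite /welfare tight_sum //= (eq_bigl xpredT) => [|r]; last exact: covered.
rewrite [X in _ + X](eq_bigl xpredT) => [|r]; last exact: covered.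
by rewrite !sumr_const card_ord mulrDr mulr1 mulr_natl.
Qed.

(** For [i >= n] both actions are worth 0. An agent [i < n] switching to [tight_opt i] sees [A_i] at
    load [n], whether it was already there ([b] true) or joins [n - 1] others, and gains [w] from
    [B_i]. *)
Lemma tight_nash (f : nat -> R) :
    f 1%N = 1 -> f n + w <= (n - ~~ b)%:R * f (n - ~~ b)%N ->
  tight_ae \in nash tight_game f.
Proof.
move=> f1 Hf; rewrite inE tight_ae_allocation /=.
apply/forallP => i; apply/forallP => c; apply/implyP.
rewrite !inE => /orP[] /eqP ->.
  suff -> : deviate tight_ae i (tight_ne i) = tight_ae by [].
  by apply/ffunP => j; rewrite !ffunE; case: eqP => [->|].
rewrite /utility !tight_sum /= ?mul0r //.
rewrite !ffunE eqxx.
rewrite [X in _ <= _ + X]big_pred0 ?addr0 => [|r]; last by rewrite inE.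
have [ilt|ige] := ltnP i n; last first.
  rewrite !big_pred0 ?addr0 // => r; rewrite !inE; first by rewrite ltnNge ige.
    by apply/negP => /eqP rE; move: (ltn_ord r); rewrite rE ltnNge ige.
  by apply/negP => /eqP rE; move: (ltn_ord r); rewrite rE ltnNge ige.
pose i' := Ordinal ilt.
rewrite (big_pred1 i') => [|r]; last by rewrite inE.
rewrite (big_pred1 i') => [|r]; last by rewrite inE.
rewrite !load_deviate ?inE //= !ffunE !inE /= tight_load_A tight_load_B.
rewrite ilt eqxx orbF /= f1 mulr1 mul1r subnKC; last by apply: ltnW.
apply: le_trans Hf _.
rewrite (eq_bigl (fun r => b || (r != i'))) => [|r]; last by rewrite inE ilt.
rewrite (eq_bigr (fun=> f (n - ~~ b)%N)) => [|r _]; last first.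
  by rewrite tight_load_A mul1r.
rewrite sumr_const mulr_natl; case: (b) => /=.
  by rewrite subn0 (eq_card (B := 'I_n)) // card_ord.
rewrite subn1 (eq_card (B := predC1 i')) => [|r]; last by rewrite inE.
by rewrite cardC1 card_ord.
Qed.

Lemma tight_PoA (f : nat -> R) :
    f 1%N = 1 -> f n + w <= (n - ~~ b)%:R * f (n - ~~ b)%N ->
  (efficiency_ratios f k !=set0)%classic /\ PoA f k <= (1 + w)^-1.
Proof.
move=> f1 Hf; have n0 : 0 < n%:R :> R by rewrite ltr0n; lia.
have w1 : 0 < 1 + w by rewrite ltr_wpDr.
rewrite -tight_cardinality.
apply: (PoA_le_nash (tight_nash f1 Hf) tight_ao_allocation).
  by rewrite tight_welfare_ao mulr_gt0.
by rewrite tight_welfare_ae tight_welfare_ao mulrCA mulVf ?mulr1 // gt_eqF.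
Qed.

End TightGame.

(** With [n = j + 1] and [b] false the equilibrium load is [j]; [w] is chosen to make the agents
    indifferent. *)
Lemma PoA_le_step (R : realType) (f : nat -> R) (k j : nat) :
    f 1%N = 1 -> (1 <= j < k)%N -> 0 <= j%:R * f j - f j.+1 ->
  (efficiency_ratios f k !=set0)%classic /\
  PoA f k <= (1 + (j%:R * f j - f j.+1))^-1.
Proof.
move=> f1 /andP[j0 jk] w0; apply: (@tight_PoA _ k j.+1 false) => //.
by rewrite subn1 /= addrC subrK.
Qed.

(** Now [n = k] and [b] is true, so indifference reads [f k + w = k f(k)]. *)
Lemma PoA_le_last (R : realType) (f : nat -> R) (k : nat) :
    f 1%N = 1 -> (1 <= k)%N -> 0 <= (k.-1)%:R * f k ->
  PoA f k <= (1 + (k.-1)%:R * f k)^-1.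
Proof.
case: k => // k f1 _ w0.
apply: (proj2 (@tight_PoA _ k.+1 k.+1 true _ _ w0 _ _ f1 _)) => //.
by rewrite subn0 -natr1 mulrDl mul1r addrC.
Qed.

Lemma PoA_eq (R : realType) (f : nat -> R) (k j0 : nat) (x : R) :
    admissible k f -> 0 <= x ->
    (forall j, (1 <= j < k)%N -> j%:R * f j - f j.+1 <= x) ->
    (k.-1)%:R * f k <= x ->
    (1 <= j0 < k)%N -> j0%:R * f j0 - f j0.+1 = x ->
  PoA f k = (1 + x)^-1.
Proof.
move=> fadm x0 Hx Hk Hj0 xE; have [_ f1 _] := fadm.
have [|ne le] := PoA_le_step f1 Hj0; first by rewrite xE.
by apply: le_anti; rewrite -{1}xE le PoA_ge.
Qed.

(** * The numbers [N k j] and the rules with equal costs *)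

Section FstarNum.
Variable R : realType.
Local Notation N := (@fstar_num R).

Lemma fstar_num_rec k j :
  (j < k)%N -> N k j = (j`!%:R)^-1 + N k j.+1.
Proof. by move=> jk; rewrite /fstar_num big_ltn // addrCA. Qed.

Lemma fstar_num_last k : N k k = ((k.-1)%:R * (k.-1)`!%:R)^-1.
Proof. by rewrite /fstar_num big_geq // addr0. Qed.

Lemma fact_gt0R n : 0 < n`!%:R :> R.
Proof. by rewrite ltr0n fact_gt0. Qed.

Lemma fstar_num_gt0 k j : (1 < k)%N -> 0 < N k j.
Proof.
move=> k1; rewrite ltr_wpDr //.
  by apply: sumr_ge0 => i _; rewrite invr_ge0 ltW ?fact_gt0R.
by rewrite invr_gt0 mulr_gt0 ?fact_gt0R // ltr0n; lia.
Qed.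

Lemma fstar_numS_lt k j : (1 < k)%N -> (j <= k)%N -> N k.+1 j < N k j.
Proof.
case: k => [//|[//|k]] _ jk.
rewrite /fstar_num big_nat_recr //= -subr_gt0.
set S := \sum_(_ <= i < _) _.
have F0 := fact_gt0R k.+1; rewrite [k.+2`!]factS natrM.
set F : R := (k.+1)`!%:R in F0 *.
have k0 : 0 < k.+1%:R :> R by rewrite ltr0n.
rewrite -[k.+2%:R]natr1; set x : R := k.+1%:R in k0 *.
have x1 : x + 1 != 0 by rewrite gt_eqF // ltr_wpDl // ltW.
(* With [k] as in the statement, [x = k - 1] and [F = x!]; the common sum [S] cancels. *)
have -> : (x * F)^-1 + S - (((x + 1) * ((x + 1) * F))^-1 + (S + ((x + 1) * F)^-1)) =
   (x * (x + 1) ^+ 2 * F)^-1.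
  by clearbody x F S; field; rewrite x1 !gt_eqF.
by rewrite invr_gt0 !mulr_gt0 ?exprn_gt0 ?ltr_wpDl ?ltW.
Qed.

Lemma fstar_num_lt k m j :
  (1 < k)%N -> (k < m)%N -> (j <= k)%N -> N m j < N k j.
Proof.
move=> k1 km jk; elim: m km => // m IH; rewrite ltnS leq_eqVlt.
case/predU1P => [<-|km]; first exact: fstar_numS_lt.
by apply: lt_trans (IH km); apply: fstar_numS_lt; lia.
Qed.

(* The rules on [k] all of whose costs j f(j) - f(j+1) and (k-1) f(k) equal c. *)
Definition flat_rule (k : nat) (c : R) (j : nat) : R :=
  (j.-1)`!%:R * (c * N k j).

Lemma flat_rule_step k c j :
  (1 <= j < k)%N -> j%:R * flat_rule k c j - flat_rule k c j.+1 = c.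
Proof.
case: j => // j jk; rewrite /flat_rule /= (fstar_num_rec (j := j.+1)) //.
rewrite mulrA -natrM -factS -mulrBr -mulrBr addrK mulrCA divff ?mulr1 //.
by rewrite gt_eqF // fact_gt0R.
Qed.

Lemma flat_rule_last k c : (1 < k)%N -> (k.-1)%:R * flat_rule k c k = c.
Proof.
move=> k1; rewrite /flat_rule fstar_num_last mulrCA !mulrA mulrAC -mulrA.
have k0 : (k.-1)%:R != 0 :> R by rewrite pnatr_eq0; lia.
have F0 : (k.-1)`!%:R != 0 :> R by rewrite gt_eqF // fact_gt0R.
by field; rewrite k0 F0.
Qed.

(** Writing [c] as the last cost of [flat_rule j c] reduces the claim to [N k j <= N j j], that is,
    to monotonicity in the first index. *)
Lemma flat_rule_pred_mul k c j : 0 <= c -> (1 < k)%N -> (1 <= j <= k)%N ->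
  (j.-1)%:R * flat_rule k c j <= c.
Proof.
move=> c0 k1 /andP[j0 jk]; case: (ltnP 1 j) => j1; last first.
  have -> : j = 1%N by lia.
  by rewrite mul0r.
rewrite -[leRHS](flat_rule_last c j1) /flat_rule.
do 3!(apply: ler_wpM2l => //).
move: jk; rewrite leq_eqVlt => /predU1P[->//|jk].
by apply/ltW/fstar_num_lt.
Qed.

Lemma flat_rule_ge0 k c j : 0 <= c -> (1 < k)%N -> 0 <= flat_rule k c j.
Proof. by move=> c0 k1; rewrite !mulr_ge0 // ltW // fstar_num_gt0. Qed.

(** Since the next value is [j f(j) - c], monotonicity amounts to [(j - 1) f(j) <= c]. *)
Lemma flat_rule_le k c j : 0 <= c -> (1 < k)%N -> (1 <= j < k)%N ->
  flat_rule k c j.+1 <= flat_rule k c j.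
Proof.
move=> c0 k1 jk; have := flat_rule_step c jk.
have : (j.-1)%:R * flat_rule k c j <= c by apply: flat_rule_pred_mul => //; lia.
by case: j jk => // j jk /=; rewrite -natr1; lra.
Qed.

Lemma fstarE k j : (1 < k)%N -> fstar R k j = flat_rule k (N k 1)^-1 j.
Proof. by move=> k1; rewrite /fstar /flat_rule leqNgt k1 [_ / _]mulrC. Qed.

Lemma fstar_cost_gt0 k : (1 < k)%N -> 0 < (N k 1)^-1.
Proof. by move=> k1; rewrite invr_gt0 fstar_num_gt0. Qed.

Lemma fstar_admissible k : (1 < k)%N -> admissible k (fstar R k).
Proof.
move=> k1; have c0 := fstar_cost_gt0 k1; split.
- by move=> j _; rewrite fstarE // flat_rule_ge0 // ltW.
- by rewrite fstarE // /flat_rule /= mul1r mulVf // gt_eqF // fstar_num_gt0.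
- by move=> j jk; rewrite !fstarE // flat_rule_le // ltW.
Qed.

Lemma admissible_sub k m (f : nat -> R) :
  (k <= m)%N -> admissible m f -> admissible k f.
Proof.
move=> km [f0 f1 fle]; split=> // j jk; [apply: f0|apply: fle]; lia.
Qed.

(** Agreement on [[k]] alone is assumed so that this covers both [fstar R m] and the extensions of
    it. For [k < m] the last cost is only bounded by the common step cost. *)
Lemma PoA_fstar_on k m (f : nat -> R) :
    (1 < k)%N -> (k <= m)%N -> admissible k f ->
    (forall j, (1 <= j <= k)%N -> f j = fstar R m j) ->
  PoA f k = (1 + (N m 1)^-1)^-1.
Proof.
move=> k1 km fadm fE; have m1 : (1 < m)%N by exact: leq_trans km.
have c0 := fstar_cost_gt0 m1.
have step j : (1 <= j < k)%N -> j%:R * f j - f j.+1 = (N m 1)^-1.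
  by move=> jk; rewrite !fE ?fstarE ?flat_rule_step //; lia.
apply: (@PoA_eq _ _ _ 1) => //.
- exact: ltW.
- by move=> j /step ->.
- by rewrite fE ?fstarE ?flat_rule_pred_mul ?ltW //; lia.
- exact: step.
Qed.

Lemma PoA_fstar k m : (1 < k)%N -> (k <= m)%N ->
  PoA (fstar R m) k = (1 + (N m 1)^-1)^-1.
Proof.
move=> k1 km; apply: PoA_fstar_on => //.
by apply: (admissible_sub km); apply: fstar_admissible; lia.
Qed.

Lemma ltr_inv1D (x y : R) : 0 < x -> x < y -> (1 + y)^-1 < (1 + x)^-1.
Proof. by move=> x0 xy; rewrite ltf_pV2 ?posrE; lra. Qed.

Lemma PoA_fstar_lt k m :
  (1 < k)%N -> (k < m)%N -> (1 + (N m 1)^-1)^-1 < (1 + (N k 1)^-1)^-1.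
Proof.
move=> k1 km; apply: ltr_inv1D; first exact: fstar_cost_gt0.
by rewrite ltf_pV2 ?posrE ?fstar_num_gt0 ?fstar_num_lt //; lia.
Qed.

(** Converse of [PoA_ge]: a cost above [x] is nonnegative, so its tight game would push the price of
    anarchy below [(1 + x)^-1]. *)
Lemma PoA_ge_costs k (f : nat -> R) (x : R) :
    admissible k f -> (1 < k)%N -> 0 <= x -> (1 + x)^-1 <= PoA f k ->
  (forall j, (1 <= j < k)%N -> j%:R * f j - f j.+1 <= x) /\
  (k.-1)%:R * f k <= x.
Proof.
move=> [_ f1 _] k1 x0 xP.
have le_x y : (0 <= y -> PoA f k <= (1 + y)^-1) -> y <= x.
  move=> yP; rewrite leNgt; apply/negP => xy.
  have y0 : 0 <= y by rewrite (le_trans x0) // ltW.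
  have := le_trans xP (yP y0).
  by rewrite lef_pV2 ?posrE; lra.
split=> [j jk|]; apply: le_x => y0; first by apply: (PoA_le_step f1 jk y0).2.
by apply: PoA_le_last => //; lia.
Qed.

Lemma flat_rule_unique k d (c : R) (f : nat -> R) j :
    (1 <= d)%N -> (1 < k)%N ->
    (forall j, (1 <= j < k)%N -> j%:R * f j - f j.+1 <= c) ->
    (k.-1)%:R * f k <= c -> f d = flat_rule k c d ->
  (d <= j <= k)%N -> f j = flat_rule k c j.
Proof.
move=> d1 k1 Hstep Hlast fd /andP[dj jk]; apply: le_anti; apply/andP; split.
  (* The last cost bounds f k from above; the steps propagate this downwards,
     and the lower bounds upwards from d. *)
  have : (1 <= j)%N by lia.
  elim: (k - j)%N {-2}j (erefl (k - j)%N) jk {dj} => [|p IH] i Hp ik i0.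
    have -> : i = k by lia.
    have kk : 0 < (k.-1)%:R :> R by rewrite ltr0n; lia.
    by rewrite -(ler_pM2l kk) flat_rule_last.
  have ik' : (1 <= i < k)%N by lia.
  have ii : 0 < i%:R :> R by rewrite ltr0n.
  have fi : f i.+1 <= flat_rule k c i.+1 by apply: IH; lia.
  rewrite -(ler_pM2l ii).
  by have := Hstep i ik'; have := flat_rule_step c ik'; lra.
elim: j dj jk => [|j IH]; first by lia.
rewrite leq_eqVlt => /predU1P[<- _|dj jk]; first by rewrite fd.
have jk' : (1 <= j < k)%N by lia.
have fj : flat_rule k c j <= f j by apply: IH; lia.
have := Hstep j jk'; have := flat_rule_step c jk'.
have : j%:R * flat_rule k c j <= j%:R * f j by apply: ler_wpM2l.
by lra.
Qed.

(** * Optimal extensions of [fstar R kd] to [[ku]] *)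

Section Extension.
Variables (kd ku : nat).
Hypotheses (kd1 : (1 < kd)%N) (kd_ku : (kd < ku)%N).

(* The value of c for which flat_rule ku c kd = fstar R kd kd. *)
Definition ext_cost : R := N kd kd / (N kd 1 * N ku kd).

(** Put [A = N kd kd], [B = N ku kd] and let [S] be the sum of [1/i!] over [1 <= i < kd]. The claim
    becomes [(S + A) B < A (S + B)], which is [B < A]. *)
Lemma ext_cost_gt : (N ku 1)^-1 < ext_cost.
Proof.
have ku1 : (1 < ku)%N by lia.
have A0 := fstar_num_gt0 kd kd1; have B0 := fstar_num_gt0 kd ku1.
have A1 := fstar_num_gt0 1 kd1; have B1 := fstar_num_gt0 1 ku1.
have AB := fstar_num_lt kd1 kd_ku (leqnn kd).
have split_at m : (kd <= m)%N ->
    N m 1 = \sum_(1 <= i < kd) (i`!%:R)^-1 + N m kd.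
  by move=> km; rewrite /fstar_num (big_cat_nat (ltnW kd1) km) /= addrCA.
have S0 : 0 < \sum_(1 <= i < kd) (i`!%:R)^-1 :> R.
  rewrite big_ltn // ltr_pwDl ?invr_gt0 ?fact_gt0R //.
  by apply: sumr_ge0 => i _; rewrite invr_ge0 ltW ?fact_gt0R.
rewrite /ext_cost ltr_pdivlMr ?mulr_gt0 // mulrC ltr_pdivrMr //.
rewrite !split_at ?(ltnW kd_ku) //; nra.
Qed.

(** Ensures that the costs before [kd] stay below those from [kd] on. *)
Lemma ext_cost_gt_fstar : (N kd 1)^-1 < ext_cost.
Proof.
have ku1 : (1 < ku)%N by lia.
have A1 := fstar_num_gt0 1 kd1; have B0 := fstar_num_gt0 kd ku1.
rewrite /ext_cost invfM mulrCA -[ltLHS]mulr1 ltr_pM2l ?invr_gt0 //.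
by rewrite ltr_pdivlMr // mul1r fstar_num_lt.
Qed.

Lemma ext_cost_gt0 : 0 < ext_cost.
Proof. exact: lt_trans (fstar_cost_gt0 kd1) ext_cost_gt_fstar. Qed.

Lemma flat_rule_ext_kd : flat_rule ku ext_cost kd = fstar R kd kd.
Proof.
have ku1 : (1 < ku)%N by lia.
rewrite fstarE // /flat_rule /ext_cost; congr (_ * _).
by field; rewrite !gt_eqF // fstar_num_gt0.
Qed.

(** An explicit competitor for the optimal extensions. Its two branches agree at [kd], so the cost
    at [kd] is [ext_cost] as well. *)
Definition fstar_ext (j : nat) : R :=
  if (j <= kd)%N then fstar R kd j else flat_rule ku ext_cost j.

Lemma fstar_ext_ge j :
  (kd <= j)%N -> fstar_ext j = flat_rule ku ext_cost j.
Proof.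
rewrite /fstar_ext leq_eqVlt => /predU1P[<-|].
  by rewrite leqnn flat_rule_ext_kd.
by rewrite ltnNge => /negPf ->.
Qed.

Lemma fstar_ext_le j : (j <= kd)%N -> fstar_ext j = fstar R kd j.
Proof. by rewrite /fstar_ext => ->. Qed.

Lemma fstar_ext_admissible : admissible ku fstar_ext.
Proof.
have ku1 : (1 < ku)%N by lia.
have [f0 f1 fle] := fstar_admissible kd1; have c0 := ltW ext_cost_gt0.
split=> [j jku||j jku]; last 1 first.
- case: (ltnP j kd) => jkd.
    by rewrite !fstar_ext_le ?fle //; lia.
  by rewrite !fstar_ext_ge ?flat_rule_le //; lia.
- case: (leqP j kd) => jkd; first by rewrite fstar_ext_le ?f0 //; lia.
  by rewrite fstar_ext_ge ?flat_rule_ge0 // ltnW.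
- by rewrite fstar_ext_le // ltnW.
Qed.

Lemma PoA_fstar_ext : PoA fstar_ext ku = (1 + ext_cost)^-1.
Proof.
have ku1 : (1 < ku)%N by lia.
apply: (@PoA_eq _ _ _ kd) => //.
- exact: fstar_ext_admissible.
- exact/ltW/ext_cost_gt0.
- move=> j jku; case: (ltnP j kd) => jkd.
    rewrite !fstar_ext_le ?fstarE ?flat_rule_step //; try lia.
    exact/ltW/ext_cost_gt_fstar.
  by rewrite !fstar_ext_ge ?flat_rule_step //; lia.
- by rewrite fstar_ext_ge ?flat_rule_last // ltnW.
- by rewrite kd_ku ltnW.
- by rewrite !fstar_ext_ge ?flat_rule_step ?kd_ku //; lia.
Qed.

(** Comparison with [fstar_ext] bounds all costs of [f] by [ext_cost]; as [f kd] is prescribed, [f]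
    is then flat from [kd] on. The cost at [kd] already occurs in cardinality [k], as [kd < k]. *)
Lemma PoA_optimal_extension (f : nat -> R) k :
    optimal_extension kd ku f -> (kd < k <= ku)%N ->
  PoA f k = (1 + ext_cost)^-1.
Proof.
move=> [fadm fE fopt] /andP[kdk kku]; have ku1 : (1 < ku)%N by lia.
have c0 := ltW ext_cost_gt0.
have [|step last] := PoA_ge_costs fadm ku1 c0.
  rewrite -PoA_fstar_ext; apply: fopt; first exact: fstar_ext_admissible.
  by move=> j /andP[_]; exact: fstar_ext_le.
have fkd : f kd = flat_rule ku ext_cost kd.
  by rewrite flat_rule_ext_kd fE // leqnn ltnW.
have flat j := flat_rule_unique (j := j) (ltnW kd1) ku1 step last fkd.
apply: (@PoA_eq _ _ _ kd) => //.
- exact: admissible_sub fadm.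
- by move=> j jk; apply: step; lia.
- have := admissible_pred_mul (j := k) fadm step last.
  have -> : k%:R = (k.-1)%:R + 1 :> R by rewrite natr1 prednK //; lia.
  by rewrite mulrDl mul1r addrK; apply; lia.
- by lia.
- by rewrite !flat ?flat_rule_step //; lia.
Qed.

End Extension.
End FstarNum.

(* The hypothesis (k = 1 -> ku = 1) excludes exactly the case k = 1 < ku, in
   which the claims fail: games of cardinality 1 have price of anarchy 1 under
   every rule f with f 1 = 1. *)
Theorem theorem1 (R : realType) (k ku : nat)
    (k_gt0 : (1 <= k)%N) (k_le_ku : (k <= ku)%N) (k1 : k = 1%N -> ku = 1%N) :
  [/\ PoA (fstar R ku) k = PoA (fstar R ku) ku,
      (k < ku)%N -> PoA (fstar R ku) k < PoA (fstar R k) k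
    & k = ku -> PoA (fstar R ku) k = PoA (fstar R k) k] /\
  (forall (kd : nat) (f' : nat -> R),
      (1 < kd)%N -> (kd < ku)%N -> optimal_extension kd ku f' ->
      ((kd < k)%N ->
         PoA f' k = PoA f' ku /\ PoA f' k < PoA (fstar R ku) k) /\
      ((k <= kd)%N ->
         PoA f' k = PoA (fstar R kd) kd /\ PoA (fstar R ku) k < PoA f' k)).
Proof.
have [k_le1|k_gt1] := leqP k 1.
  (* Here [ku = 1] too, so no [kd] satisfies [1 < kd < ku]. *)
  have kE : k = 1%N by lia.
  have kuE := k1 kE; subst k ku; split; last by move=> kd f'; lia.
  by split.
have ku_gt1 : (1 < ku)%N by exact: leq_trans k_le_ku.
split.
  rewrite !PoA_fstar //; split=> // [kku|<-//].
  exact: PoA_fstar_lt.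
move=> kd f' kd1 kd_ku fopt; rewrite !PoA_fstar //; split=> kkd.
  rewrite !(PoA_optimal_extension kd1 kd_ku fopt) ?kkd ?kd_ku ?leqnn //.
    by split=> //; apply: ltr_inv1D; [exact: fstar_cost_gt0|exact: ext_cost_gt].
(* For [k <= kd], only the part of [f'] that equals [fstar R kd] is seen. *)
have [fadm fE _] := fopt.
rewrite (PoA_fstar_on k_gt1 kkd (admissible_sub k_le_ku fadm)).
  by split=> //; exact: PoA_fstar_lt.
by move=> j jk; apply: fE; lia.
Qed.
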